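(* There exist absolute constants $C_0,\epsilon_0>0$ such that the following holds. Let $\mathcal{A}\subset S_n$ with $|\mathcal{A}|=c(n-1)!$, where $c\le n/2$, and let $f=\mathbf{1}_{\mathcal{A}}:S_n\to\{0,1\}$ be the characteristic function of $\mathcal{A}$, so that $\mathbb{E}[f]=c/n$. Let $f_1$ denote the orthogonal projection of $f$ onto $U_1$. If $\mathbb{E}[(f-f_1)^2]\le \epsilon c/n$, where $\epsilon\le\epsilon_0$, then there exists a Boolean function $\tilde f:S_n\to\{0,1\}$ such that $$\mathbb{E}[(f-\tilde f)^2]\le C_0c^2(\epsilon^{1/2}+1/n)/n,$$ and $\tilde f$ is the characteristic function of a union of $\operatorname{round}(c)$ 1-cosets of $S_n$. Moreover, $|c-\operatorname{round}(c)|\le C_0c^2(\epsilon^{1/2}+1/n)$.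
   Context: $S_n$ is the symmetric group on $[n]=\{1,\dots,n\}$. For $i,j\in[n]$, $T_{ij}=\{\sigma\in S_n:\sigma(i)=j\}$; the sets $T_{ij}$ are called the 1-cosets of $S_n$. Expectations $\mathbb{E}$ are with respect to the uniform probability measure on $S_n$, and functions on $S_n$ carry the inner product $\langle f,g\rangle=\frac{1}{n!}\sum_{\sigma\in S_n}f(\sigma)\overline{g(\sigma)}$, with respect to which orthogonal projections are taken. $U_1=\mathrm{Span}\{\mathbf{1}_{T_{ij}}: i,j\in[n]\}$. $\operatorname{round}(c)$ is the nearest integer to $c$, rounding up if $c\in\mathbb{Z}+\tfrac12$. Here $c$ is a real number (not necessarily an integer), and the constants $C_0,\epsilon_0$ do not depend on $n$, $c$, $\epsilon$ or $\mathcal{A}$. A union of 1-cosets need not be a disjoint union. *)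

(* Defs.v *)
From HB Require Import structures.
From mathcomp Require Import all_boot all_order all_algebra all_fingroup.
From mathcomp Require Import reals.
From mathcomp Require Import complex.

Set Implicit Arguments.
Unset Strict Implicit.
Unset Printing Implicit Defensive.

Import Order.TTheory GRing.Theory Num.Theory.

Local Open Scope ring_scope.
Local Open Scope complex_scope.

(* The complex vector space of functions on S_n. The codomain is R[i]^o (the
   field R[i] seen as a vector space over itself), so that the function type
   carries the vector-space structure needed to speak of spans. *)
Notation fun_Sn R n := {ffun 'S_n -> R[i]^o}.

Definition expect (R : realType) (n : nat) (g : 'S_n -> R[i]) : R[i] :=
  (n`!%:R)^-1 * \sum_(s : 'S_n) g s.

Definition inner (R : realType) (n : nat) (f g : fun_Sn R n) : R[i] :=
  expect (fun s => f s * Num.conj (g s)).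

Definition indic (R : realType) (n : nat) (A : {set 'S_n}) : fun_Sn R n :=
  [ffun s => (s \in A)%:R].

Definition coset1 (n : nat) (i j : 'I_n) : {set 'S_n} :=
  [set s : 'S_n | s i == j].

(* For n = 2 distinct pairs (i, j) can give the same 1-coset, so cosets are
   counted as sets of permutations rather than as pairs. *)
Definition cosets1 (n : nat) : {set {set 'S_n}} :=
  [set coset1 i j | i : 'I_n, j : 'I_n].

Definition U1 (R : realType) (n : nat) : {vspace fun_Sn R n} :=
  <<[seq indic R (coset1 ij.1 ij.2) | ij : 'I_n * 'I_n]>>%VS.

Definition is_orthogonal_projection (R : realType) (n : nat)
    (U : {vspace fun_Sn R n}) (f f1 : fun_Sn R n) : Prop :=
  f1 \in U /\ (forall g : fun_Sn R n, g \in U -> inner (f - f1) g = 0).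

Definition round (R : realType) (c : R) : int := Num.floor (c + 2^-1).

Definition Boolean_fun (R : realType) (n : nat) (f : fun_Sn R n) : Prop :=
  forall s, f s = 0 \/ f s = 1.

(* Main.v *)
Require Import Defs.
From HB Require Import structures.
From mathcomp Require Import all_boot all_order all_algebra all_fingroup.
From mathcomp Require Import reals.
From mathcomp Require Import complex.
From mathcomp Require Import ring lra zify.

Set Implicit Arguments.
Unset Strict Implicit.
Unset Printing Implicit Defensive.

Import Order.TTheory GRing.Theory Num.Theory.

Local Open Scope ring_scope.
Local Open Scope complex_scope.

(** Write P = (n-1)!, let a_ij = |A ∩ T_ij| / P be the density of A in the
    1-coset T_ij (so every row and column of the matrix a sums to c), and let
    d_ij = a_ij - c/n. Put h(s) = Σ_i d_(i, s(i)). The projection f1 is then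
    explicit: f1 = c/n + ((n-1)/n) h ([level1_projection]).

    Since d has zero row and column sums, the moments of h are exact:
    E[h^2] is a multiple of D2 = Σ d_ij^2 and E[h^3] is a multiple of
    D3 = Σ d_ij^3 ([sum_permsum2], [sum_permsum3]). The hypothesis
    E[(f - f1)^2] <= eps c/n gives D2 ≈ c. Because f1 >= -c pointwise, the
    elementary inequality f1^3 >= f + 3 f (f1 - f) - c (f1 - f)^2 for f in
    {0, 1} turns the same L2 hypothesis into a lower bound on E[f1^3]
    ([level1_cube_ge]), so that D3 is at least about c as well. Hence
      Σ d_ij^2 (1 - d_ij) = D2 - D3 = O(c^2 (eps + 1/n))
    ([level1_moment_bounds]). As d_ij <= 1, all terms on the left are
    nonnegative, and therefore every d_ij is close to 0 or to 1 in an averaged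
    sense.

    Let M be the set of pairs with d_ij >= 1/2, and m = |M|. Then
    |m - c| and Σ_M (1 - d_ij) are both O(c^2 (eps + 1/n))
    ([heavy_bounds]). Distinct 1-cosets meet in at most P/(n-1) permutations,
    so the union of a family of r cosets differs from A by at most
    P (c + r - 2 Σ a_ij + r^2/(n-1)) permutations ([symmdiff_cover]). This is
    applied to a set of r = round(c) pairs that is comparable with M for
    inclusion: as |m - r| <= 2 |m - c|, adding or removing pairs costs no more
    than the error already present ([coset_approximation]).

    This needs n > 20 and c >= 1/2. If n > 20 and c < 1/2, then
    d_ij <= 1/2 everywhere, so D3 <= D2 / 2, which contradicts the closeness of
    D2 and D3 unless c = 0 ([sparse_set_empty]). If n <= 20, then c is either 0
    or at least 1/19!, and a large C0 makes the bounds trivial. Finally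
    eps <= sqrt(eps). *)

(* The unqualified name denotes a lemma on cosets of quotient groups. *)
Local Notation coset1 := Defs.coset1.

(** * Moments of permutation sums *)

Section Averaging.

Variables (R : realFieldType) (n : nat).
Implicit Types (K : {set 'I_n}) (psi : 'S_n -> R) (v : 'I_n -> R) (s : 'S_n).

(** As transpositions of points outside K generate the pointwise stabilizer of
    K, this says that [psi s] is determined by the restriction of [s] to K. *)
Definition depends_on K psi :=
  forall p q s, p \notin K -> q \notin K -> psi (tperm p q * s)%g = psi s.

(** Conditionally on the restriction of [s] to K, the value [s p] is uniformly
    distributed over the values that [s] takes outside K: precomposing with the
    transposition of p and q replaces [s p] by [s q] and leaves [psi] unchanged.
    All the expectations below come from this identity. *)
Lemma sum_exchange K psi v p : depends_on K psi -> p \notin K ->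
  (n - #|K|)%:R * (\sum_s psi s * v (s p)) =
  \sum_s psi s * \sum_(q | q \notin K) v (s q).
Proof.
move=> psiK pK.
have swap q : q \notin K -> \sum_s psi s * v (s p) = \sum_s psi s * v (s q).
  move=> qK; rewrite (reindex_inj (mulgI (tperm p q))) /=.
  by apply: eq_bigr => s _; rewrite psiK // permM tpermL.
under [RHS]eq_bigr do rewrite big_distrr /=.
rewrite exchange_big /= -(eq_bigr _ swap) sumr_const mulr_natl; congr (_ *+ _).
by have := cardC K; rewrite card_ord => {1}<-; rewrite addKn; apply: eq_card.
Qed.

Lemma sum_perm_at v i : \sum_(s : 'S_n) v (s i) = n.-1`!%:R * \sum_j v j.
Proof.
have n0 : (0 < n)%N by apply: leq_ltn_trans (ltn_ord i).
have nN0 : n%:R != 0 :> R by rewrite pnatr_eq0 -lt0n.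
have := @sum_exchange set0 (fun=> 1) v i (fun _ _ _ _ _ => erefl).
rewrite inE cards0 subn0 => /(_ isT) ex; apply: (mulfI nN0).
transitivity (\sum_(s : 'S_n) \sum_j v j).
  rewrite -[X in _ * X](eq_bigr _ (fun s _ => mul1r (v (s i)))) ex.
  apply: eq_bigr => s _; rewrite mul1r (reindex_perm s^-1) /=.
  by apply: eq_big => [q|q _]; rewrite ?inE ?permKV.
have -> : n.-1`!%:R = n`!%:R / n%:R :> R.
  by case: (n) n0 nN0 => // m _ m0; rewrite factS natrM mulrC mulKf.
rewrite sumr_const card_Sn -mulr_natl; field; exact: nN0.
Qed.

Lemma sum_notin K v : \sum_q v q = 0 ->
  \sum_(q | q \notin K) v q = - \sum_(q in K) v q.
Proof.
by rewrite (bigID (fun q => q \in K)) /= addrC => /eqP; rewrite addr_eq0 => /eqP.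
Qed.

Variable d : 'I_n -> 'I_n -> R.
Hypothesis row0 : forall i, \sum_j d i j = 0.
Hypothesis col0 : forall j, \sum_i d i j = 0.

Lemma row_perm0 p s : \sum_q d p (s q) = 0.
Proof. by rewrite -[RHS](row0 p) [RHS](reindex_inj (@perm_inj _ s)). Qed.

Definition permsum s := \sum_i d i (s i).

(** Given the restriction of [s] to K, the remaining rows and columns of [d] form
    a matrix whose total is the sum over the K block, by the zero row and
    column sums, and each of its entries is hit equally often. *)
Lemma sum_permsum K psi : depends_on K psi ->
  (n - #|K|)%:R * (\sum_s psi s * (permsum s - \sum_(k in K) d k (s k))) =
  \sum_s psi s * \sum_(k in K) \sum_(l in K) d l (s k).
Proof.
move=> psiK.
transitivity (\sum_(p | p \notin K) (n - #|K|)%:R * \sum_s psi s * d p (s p)).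
  rewrite -big_distrr /= exchange_big /=; congr (_ * _); apply: eq_bigr => s _.
  rewrite -big_distrr /=; congr (_ * _).
  by rewrite /permsum (bigID (fun k => k \in K)) /= [LHS]addrC addKr.
transitivity (\sum_(p | p \notin K) \sum_s psi s * - \sum_(k in K) d p (s k)).
  apply: eq_bigr => p pK; rewrite (sum_exchange _ psiK pK); apply: eq_bigr => s _.
  by rewrite (@sum_notin _ (fun q => d p (s q))) // row_perm0.
rewrite exchange_big /=; apply: eq_bigr => s _; rewrite -big_distrr /=.
congr (_ * _); rewrite sumrN exchange_big -sumrN /=; apply: eq_bigr => k kK.
by rewrite sum_notin ?opprK.
Qed.

Hypothesis n_gt2 : (2 < n)%N.
Let N : R := n%:R.
Let P : R := n.-1`!%:R.

Lemma sum_at_two (F : 'I_n -> R) i k : k != i ->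
  (N - 1) * (\sum_(s : 'S_n) F (s i) * d k (s k)) = - (P * \sum_j F j * d k j).
Proof.
move=> ki; have := @sum_exchange [set i] (fun s => F (s i)) (d k) k.
rewrite cards1 natrB ?(ltn_trans _ n_gt2)// => -> //; last 2 first.
- move=> p q s; rewrite !inE => pi qi; congr (F _).
  by rewrite permM tpermD.
- by rewrite inE.
rewrite -(sum_perm_at (fun j => F j * d k j) i) -sumrN; apply: eq_bigr => s _.
by rewrite (@sum_notin _ (fun q => d k (s q))) ?row_perm0 // big_set1 mulrN.
Qed.

Lemma sum_at_permsum (F : 'I_n -> R) i :
  (N - 1) * (\sum_(s : 'S_n) F (s i) * permsum s) = N * P * \sum_j F j * d i j.
Proof.
have split s : F (s i) * permsum s =
    F (s i) * d i (s i) + \sum_(k | k != i) F (s i) * d k (s k).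
  by rewrite -big_distrr -mulrDr /permsum (bigD1 i).
have rest : (N - 1) * (\sum_(k | k != i) \sum_(s : 'S_n) F (s i) * d k (s k)) =
    P * \sum_j F j * d i j.
  rewrite big_distrr /= (eq_bigr _ (fun k ki => sum_at_two F ki)).
  rewrite sumrN -big_distrr /= exchange_big /= -mulrN -sumrN; congr (_ * _).
  apply: eq_bigr => j _; rewrite -big_distrr -mulrN /=; congr (_ * _).
  by have /eqP := col0 j; rewrite (bigD1 i) //= addr_eq0 => /eqP <-.
rewrite (eq_bigr _ (fun s _ => split s)) big_split /= mulrDr exchange_big /= rest.
by rewrite (sum_perm_at (fun j => F j * d i j)) -/P; ring.
Qed.

Lemma sum_permsum1 : \sum_s permsum s = 0.
Proof.
rewrite exchange_big big1 //= => i _.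
by rewrite sum_perm_at row0 mulr0.
Qed.

Lemma sum_permsum2 :
  (N - 1) * (\sum_s permsum s ^+ 2) = N * P * \sum_i \sum_j d i j ^+ 2.
Proof.
have split s : permsum s ^+ 2 = \sum_i d i (s i) * permsum s.
  by rewrite -big_distrl.
rewrite (eq_bigr _ (fun s _ => split s)) exchange_big /= !big_distrr /=.
apply: eq_bigr => i _; rewrite (sum_at_permsum (d i)).
by congr (_ * _); apply: eq_bigr.
Qed.

(** Conditioning on both [s i] and [s k] gives terms in which the product
    [d i (s i) * d k (s k)] is multiplied by an entry from the rows i and k only;
    these are then reduced by conditioning on a single value. *)
Lemma sum_pair_permsum i k : k != i ->
  (N - 1) * (N - 2) * (\sum_(s : 'S_n) d i (s i) * d k (s k) * permsum s) =
  - (N * P * \sum_j (d i j ^+ 2 * d k j + d k j ^+ 2 * d i j)).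
Proof.
move=> ki; have ik : i != k by rewrite eq_sym.
have := @sum_permsum [set i; k] (fun s => d i (s i) * d k (s k)).
rewrite cards2 ik natrB ?(ltn_trans _ n_gt2)// -/N => inv.
have sumK (F : 'I_n -> R) : \sum_(l in [set i; k]) F l = F i + F k.
  by rewrite big_setU1 ?inE // big_set1.
have e1 := sum_at_two (fun j => d i j ^+ 2) ki.
have e2 := sum_at_two (fun j => d k j ^+ 2) ik.
have e3 := sum_at_two (fun j => d i j * d k j) ki.
have e4 := sum_at_two (fun j => d k j * d i j) ik.
set X := \sum_s _; set Z := \sum_j _.
have {}inv : (N - 2) * X =
    (N - 1) * (\sum_(s : 'S_n) d i (s i) ^+ 2 * d k (s k))
  + (N - 1) * (\sum_(s : 'S_n) d k (s k) ^+ 2 * d i (s i))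
  + (\sum_(s : 'S_n) d i (s i) * d k (s i) * d k (s k))
  + (\sum_(s : 'S_n) d k (s k) * d i (s k) * d i (s i)).
  have -> : X = \sum_(s : 'S_n) d i (s i) * d k (s k) *
         (permsum s - \sum_(k0 in [set i; k]) d k0 (s k0))
       + (\sum_(s : 'S_n) d i (s i) ^+ 2 * d k (s k))
       + (\sum_(s : 'S_n) d k (s k) ^+ 2 * d i (s i)).
    rewrite -!big_split; apply: eq_bigr => s _ /=.
    by rewrite sumK; ring.
  rewrite 2!mulrDr inv; last first.
    move=> p q s; rewrite !inE !negb_or => /andP[pi pk] /andP[qi qk].
    by rewrite !permM !tpermD.
  rewrite !big_distrr -!big_split; apply: eq_bigr => s _ /=.
  by rewrite !sumK; ring.
have -> : (N - 1) * (N - 2) * X = (N - 1) * ((N - 2) * X) by ring.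
have sq a b : \sum_j d a j * d b j * d b j = \sum_j d b j ^+ 2 * d a j.
  by apply: eq_bigr => j _; ring.
rewrite sq in e3; rewrite sq in e4.
by rewrite inv !mulrDr e1 e2 e3 e4 /Z big_split /=; ring.
Qed.

(** In the expansion of the cube, the diagonal pairs (i, i) contribute
    [N * (N - 2)] and the pairs i <> k contribute [2 * N], because the zero
    column sums collapse the sum over k. *)
Lemma sum_permsum3 :
  (N - 1) * (N - 2) * (\sum_s permsum s ^+ 3) =
  N ^+ 2 * P * \sum_i \sum_j d i j ^+ 3.
Proof.
have split s : permsum s ^+ 3 = \sum_i (d i (s i) ^+ 2 * permsum s +
    \sum_(k | k != i) d i (s i) * d k (s k) * permsum s).
  rewrite exprS expr2 mulrA; rewrite {1}/permsum !big_distrl; apply: eq_bigr => i _ /=.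
  rewrite -big_distrl -mulrDl; congr (_ * _).
  by rewrite -big_distrr {1}/permsum (bigD1 i) //= mulrDr.
rewrite (eq_bigr _ (fun s _ => split s)) exchange_big /= !big_distrr /=.
transitivity (\sum_i ((N - 2) * (N * P * \sum_j d i j ^+ 3)
  - N * P * \sum_(k | k != i) \sum_j (d i j ^+ 2 * d k j + d k j ^+ 2 * d i j))).
  apply: eq_bigr => i _; rewrite big_split /= mulrDr; congr (_ + _).
    rewrite mulrAC mulrC (sum_at_permsum (fun j => d i j ^+ 2)); congr (_ * (_ * _)).
    by apply: eq_bigr => j _; ring.
  rewrite exchange_big /= !big_distrr -sumrN; apply: eq_bigr => k ki /=.
  exact: sum_pair_permsum.
rewrite sumrB -!big_distrr /=.
have -> : \sum_i \sum_(k | k != i) \sum_j (d i j ^+ 2 * d k j + d k j ^+ 2 * d i j)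
   = - (2 * \sum_i \sum_j d i j ^+ 3).
  transitivity (\sum_i \sum_j (d i j ^+ 2 * - d i j) +
                \sum_k \sum_j (d k j ^+ 2 * - d k j)).
    have -> : \sum_i \sum_(k | k != i) \sum_j (d i j ^+ 2 * d k j + d k j ^+ 2 * d i j)
      = \sum_i \sum_(k | k != i) \sum_j d i j ^+ 2 * d k j
      + \sum_k \sum_(i | i != k) \sum_j d k j ^+ 2 * d i j.
      rewrite [X in _ + X](exchange_big_dep predT) //= -big_split.
      apply: eq_bigr => i _ /=.
      under [X in _ = _ + X]eq_bigl do rewrite eq_sym.
      by rewrite -big_split; apply: eq_bigr => k _; rewrite -big_split.
    congr (_ + _); apply: eq_bigr => i _; rewrite exchange_big; apply: eq_bigr => j _ /=;
    rewrite -big_distrr /=; congr (_ * _);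
    by have /eqP := col0 j; rewrite (bigD1 i) //= addrC addr_eq0 => /eqP.
  rewrite -mulr_natl -mulrN.
  have cube : \sum_i \sum_j d i j ^+ 2 * - d i j = - \sum_i \sum_j d i j ^+ 3.
    rewrite -sumrN; apply: eq_bigr => i _; rewrite -sumrN; apply: eq_bigr => j _; ring.
  by rewrite cube; ring.
by ring.
Qed.

End Averaging.

(** * The level-one part of an indicator function *)

Lemma sum_mem (R : realFieldType) (T : finType) (B : {set T}) (F : T -> R) :
  \sum_s (s \in B)%:R * F s = \sum_(s in B) F s.
Proof.
by rewrite [RHS]big_mkcond; apply: eq_bigr => s _; case: ifP; rewrite ?mul1r ?mul0r.
Qed.

Lemma sum_pick (R : realFieldType) n (F : 'I_n -> R) k : \sum_j F j * (k == j)%:R = F k.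
Proof.
rewrite (bigD1 k) //= eqxx mulr1 big1 ?addr0// => j.
by rewrite eq_sym => /negPf ->; rewrite mulr0.
Qed.

Lemma sum_pick1 (R : realFieldType) n (k : 'I_n) : \sum_j (k == j)%:R = 1 :> R.
Proof. by rewrite -[RHS](sum_pick (fun=> 1) k); apply: eq_bigr => j _; rewrite mul1r. Qed.

Lemma sum_pick_perm (R : realFieldType) n (s : 'S_n) j : \sum_i (s i == j)%:R = 1 :> R.
Proof.
rewrite -[RHS](sum_pick1 R (s^-1 j)%g); apply: eq_bigr => i _.
by rewrite (canF_eq (permK s)) eq_sym.
Qed.

Lemma sum_coset (R : realFieldType) n (i j : 'I_n) :
  \sum_(s : 'S_n) (s i == j)%:R = n.-1`!%:R :> R.
Proof.
rewrite (sum_perm_at (fun k => (k == j)%:R)).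
have -> : \sum_k (k == j)%:R = 1 :> R; last by rewrite mulr1.
by rewrite -[RHS](sum_pick1 R j); apply: eq_bigr => k _; rewrite eq_sym.
Qed.

Section CosetDensities.

Variables (R : realFieldType) (n : nat) (A : {set 'S_n}).
Hypothesis n_gt2 : (2 < n)%N.
Let N : R := n%:R.
Let P : R := n.-1`!%:R.

(** The number c of the theorem: the size of A measured in 1-cosets. *)
Definition relsize : R := #|A|%:R / P.
Definition cosetdens (i j : 'I_n) : R := #|A :&: coset1 i j|%:R / P.
Definition excess (i j : 'I_n) : R := cosetdens i j - relsize / N.
(** The orthogonal projection of the indicator of A onto the span of the
    1-cosets; see [level1_projection]. *)
Definition level1 (s : 'S_n) : R := relsize / N + (N - 1) / N * permsum excess s.

Local Notation c := relsize.
Local Notation a := cosetdens.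
Local Notation d := excess.
Local Notation h := (permsum excess).
Local Notation g := level1.
Local Notation D2 := (\sum_i \sum_j d i j ^+ 2).
Local Notation D3 := (\sum_i \sum_j d i j ^+ 3).

Lemma fact_pred_gt0 : 0 < P. Proof. by rewrite ltr0n fact_gt0. Qed.
Lemma natr_ge3 : 3 <= N. Proof. by rewrite ler_nat. Qed.
Let P0 : P != 0. Proof. by rewrite lt0r_neq0 ?fact_pred_gt0. Qed.
Let N0 : N != 0. Proof. by have := natr_ge3; apply: contraTneq => ->; lra. Qed.
Let N1 : N - 1 != 0. Proof. by have := natr_ge3; rewrite subr_eq0; apply: contraTneq => ->; lra. Qed.
Let N2 : N - 2 != 0. Proof. by have := natr_ge3; rewrite subr_eq0; apply: contraTneq => ->; lra. Qed.

Lemma factr_mul : n`!%:R = N * P.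
Proof. by rewrite -natrM -[in n`!](ltn_predK n_gt2) factS (ltn_predK n_gt2). Qed.

Lemma cosetdensE i j : a i j = (\sum_(s in A) (s i == j)%:R) / P.
Proof.
rewrite /a -sum1_card natr_sum; congr (_ / _).
rewrite [RHS]big_mkcond [LHS]big_mkcond; apply: eq_bigr => s _.
by rewrite !inE; do 2 case: ifP => //=; case: eqP.
Qed.

Lemma sum_in1 : \sum_(s in A) 1 = c * P.
Proof. by rewrite sumr_const /c divfK. Qed.

Lemma cosetdens_row i : \sum_j a i j = c.
Proof.
under eq_bigr do rewrite cosetdensE.
rewrite -big_distrl exchange_big /=; apply: (canLR (mulfK P0)); rewrite -sum_in1.
by apply: eq_bigr => s _; exact: sum_pick1.
Qed.

Lemma cosetdens_col j : \sum_i a i j = c.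
Proof.
under eq_bigr do rewrite cosetdensE.
rewrite -big_distrl exchange_big /=; apply: (canLR (mulfK P0)); rewrite -sum_in1.
by apply: eq_bigr => s _; exact: sum_pick_perm.
Qed.

Let sum_mean : \sum_(j < n) c / N = c.
Proof. by rewrite sumr_const card_ord -mulr_natl mulrCA mulfV ?mulr1. Qed.

Lemma excess_row i : \sum_j d i j = 0.
Proof. by rewrite sumrB cosetdens_row sum_mean subrr. Qed.

Lemma excess_col j : \sum_i d i j = 0.
Proof. by rewrite sumrB cosetdens_col sum_mean subrr. Qed.

Lemma relsize_ge0 : 0 <= c. Proof. by rewrite divr_ge0. Qed.
Lemma cosetdens_ge0 i j : 0 <= a i j. Proof. by rewrite divr_ge0. Qed.

Lemma cosetdens_le i j : a i j <= c.
Proof. by rewrite ler_pM2r ?invr_gt0 ?fact_pred_gt0// ler_nat subset_leq_card ?subsetIl. Qed.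

Lemma card_coset1 (i j : 'I_n) : #|coset1 i j|%:R = P.
Proof.
rewrite /P -(sum_coset R i j).
rewrite -sum1_card natr_sum big_mkcond; apply: eq_bigr => s _.
by rewrite inE; case: eqP.
Qed.

Lemma cosetdens_le1 i j : a i j <= 1.
Proof.
by rewrite ler_pdivrMr ?fact_pred_gt0// mul1r -(card_coset1 i j) ler_nat subset_leq_card ?subsetIr.
Qed.

Lemma mean_ge0 : 0 <= c / N. Proof. by rewrite divr_ge0 ?relsize_ge0. Qed.

Lemma excess_le i j : d i j <= a i j.
Proof. by rewrite gerBl mean_ge0. Qed.

Lemma excess_le1 i j : d i j <= 1.
Proof. exact: le_trans (excess_le i j) (cosetdens_le1 i j). Qed.

(** All the densities are nonnegative, so [h >= - c]. This one-sided bound is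
    what makes the cube estimate below hold term by term. *)
Lemma level1_ge s : - c <= g s.
Proof.
have hs : - c <= h s.
  rewrite /permsum sumrB sum_mean lerDr; apply: sumr_ge0 => i _; exact: cosetdens_ge0.
have -> : g s = - c + (2 * c / N + (N - 1) / N * (h s + c)) by rewrite /g; field.
have := natr_ge3; have := relsize_ge0 => c0 N3.
rewrite lerDl addr_ge0 ?mulr_ge0 ?invr_ge0//; lra.
Qed.

Lemma sum_excess2 : D2 = \sum_i \sum_j d i j * a i j.
Proof.
apply/eqP; rewrite -subr_eq0; apply/eqP; rewrite -sumrB big1 // => i _.
rewrite -sumrB; transitivity (\sum_j d i j * - (c / N)).
  by apply: eq_bigr => j _; rewrite /d; ring.
by rewrite -big_distrl /= excess_row mul0r.
Qed.

Lemma sum_in_permsum : \sum_(s in A) h s = P * D2.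
Proof.
rewrite exchange_big /= sum_excess2 big_distrr; apply: eq_bigr => i _ /=.
under [in RHS]eq_bigr do rewrite cosetdensE.
rewrite big_distrr /=.
transitivity (\sum_(s in A) \sum_j d i j * (s i == j)%:R).
  by apply: eq_bigr => s _; rewrite sum_pick.
rewrite exchange_big; apply: eq_bigr => j _ /=.
by rewrite -big_distrr /=; field; exact: P0.
Qed.

Lemma level1_coset_sum s : g s = \sum_(p : 'I_n * 'I_n)
  (c / N ^+ 2 + (N - 1) / N * d p.1 p.2) * (s p.1 == p.2)%:R.
Proof.
rewrite -(pair_bigA _ (fun i j => (c / N ^+ 2 + (N - 1) / N * d i j) * (s i == j)%:R)) /=.
rewrite (eq_bigr _ (fun i _ => sum_pick _ (s i))) big_split /=.
rewrite sumr_const card_ord -[_ *+ _]mulr_natl -/N -big_distrr /=; congr (_ + _).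
by field; exact: N0.
Qed.

Lemma level1_orthogonal i j :
  \sum_s ((s \in A)%:R - g s) * (s i == j)%:R = 0.
Proof.
have H := sum_at_permsum excess_row excess_col n_gt2 (fun k => (k == j)%:R) i.
have ij : \sum_k (k == j)%:R * d i k = d i j.
  by rewrite -[RHS](sum_pick (d i)); apply: eq_bigr => k _; rewrite mulrC eq_sym.
rewrite ij in H.
have TA : \sum_(s in A) (s i == j)%:R = a i j * P by rewrite cosetdensE divfK.
transitivity (\sum_s ((s \in A)%:R * (s i == j)%:R - c / N * (s i == j)%:R
    - N^-1 * ((N - 1) * ((s i == j)%:R * h s)))).
  by apply: eq_bigr => s _; rewrite /g; field; exact: N0.
rewrite !sumrB -!big_distrr /= H sum_coset.
by rewrite sum_mem TA /d -/N -/P; field; exact: N0.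
Qed.

Lemma sum_level1_sqr : \sum_s g s ^+ 2 = P * (c ^+ 2 + (N - 1) * D2) / N.
Proof.
have H2 := sum_permsum2 excess_row excess_col n_gt2.
transitivity (\sum_s ((c / N) ^+ 2 + (2 * (c / N) * ((N - 1) / N) * h s)
    + ((N - 1) / N ^+ 2) * ((N - 1) * h s ^+ 2))).
  by apply: eq_bigr => s _; rewrite /g; field.
rewrite !big_split /= -!big_distrr /= H2 sum_permsum1; last exact: excess_row.
by rewrite sumr_const card_Sn -[_ *+ _]mulr_natl factr_mul -/N -/P; field.
Qed.

(** As f1 is a projection of f, <f, f1> = <f1, f1>; here both sides are
    computed. *)
Lemma sum_in_level1 : \sum_(s in A) g s = \sum_s g s ^+ 2.
Proof.
transitivity (c / N * \sum_(s in A) 1 + (N - 1) / N * \sum_(s in A) h s).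
  by rewrite !big_distrr -big_split; apply: eq_bigr => s _ /=; rewrite mulr1.
by rewrite sum_in1 sum_in_permsum sum_level1_sqr; field; exact: N0.
Qed.

Lemma sum_level1_cube : \sum_s g s ^+ 3 =
  P * (c ^+ 3 + 3 * c * (N - 1) * D2 + N * (N - 1) ^+ 2 / (N - 2) * D3) / N ^+ 2.
Proof.
have H2 := sum_permsum2 excess_row excess_col n_gt2.
have H3 := sum_permsum3 excess_row excess_col n_gt2.
transitivity (\sum_s ((c / N) ^+ 3 + 3 * (c / N) ^+ 2 * ((N - 1) / N) * h s
    + 3 * (c / N) * ((N - 1) / N ^+ 2) * ((N - 1) * h s ^+ 2)
    + ((N - 1) ^+ 2 / (N ^+ 3 * (N - 2))) * ((N - 1) * (N - 2) * h s ^+ 3))).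
  by apply: eq_bigr => s _; rewrite /g; field; rewrite N0 N2.
rewrite !big_split /= -!big_distrr /= H2 H3 sum_permsum1; last exact: excess_row.
by rewrite sumr_const card_Sn -[_ *+ _]mulr_natl factr_mul -/N -/P; field; rewrite N0 N2.
Qed.

Let f s : R := (s \in A)%:R.
Local Notation Q := (\sum_s (f s - g s) ^+ 2).

Lemma level1_error : Q = c * P - \sum_s g s ^+ 2.
Proof.
transitivity (\sum_s (f s * 1 + g s ^+ 2 - 2 * (f s * g s))).
  by apply: eq_bigr => s _; rewrite /f; case: (s \in A) => /=; ring.
rewrite sumrB big_split /= -big_distrr /=.
by rewrite !sum_mem sum_in1 sum_in_level1; ring.
Qed.

(** Termwise, with x = f1(s): if s is outside A the difference of the two sides
    is x^2 (x + c), and if s is in A it is (1 - x)^2 (x + 2 + c); both are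
    nonnegative because x >= -c. The linear terms are summed exactly using
    <f, f1> = <f1, f1>. *)
Lemma level1_cube_ge : c * P - (3 + c) * Q <= \sum_s g s ^+ 3.
Proof.
have -> : c * P - (3 + c) * Q = \sum_s (f s * (3 * g s - 2) - c * (f s - g s) ^+ 2).
  rewrite sumrB -[in RHS]big_distrr /= sum_mem sumrB /= -big_distrr /= sum_in_level1.
  have -> : \sum_(s in A) 2 = 2 * (c * P) :> R by rewrite -sum_in1 big_distrr /= mulr1.
  by have := level1_error; set q := \sum_s _ => ->; ring.
apply: ler_sum => s _; have := level1_ge s; have := relsize_ge0.
rewrite /f; move: (g s) => x c0 xc; case: (s \in A) => /=; rewrite -subr_ge0.
  have -> : x ^+ 3 - (1 * (3 * x - 2) - c * (1 - x) ^+ 2) = (1 - x) ^+ 2 * (x + 2 + c) by ring.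
  by rewrite mulr_ge0 ?sqr_ge0//; lra.
have -> : x ^+ 3 - (0 * (3 * x - 2) - c * (0 - x) ^+ 2) = x ^+ 2 * (x + c) by ring.
by rewrite mulr_ge0 ?sqr_ge0//; lra.
Qed.

End CosetDensities.

(** * Densities are nearly 0 or 1 *)

(** The second-moment identity pins D2 between about c (1 - e) and c. Inserting
    the upper bound in the cubic inequality bounds D3 from below by
    c (1 - (3 + c) e) - 3 c^2 / N - c / N; the last term pays for the factor
    (N - 1)^2 / (N (N - 2)) = 1 + 1 / (N (N - 2)) of D3. *)
Lemma moment_bounds (R : realFieldType) (N c e D2 D3 : R) :
  4 <= N -> 0 <= c -> c <= N / 2 -> 0 <= e -> e <= 2^-1 -> 0 <= D2 -> D3 <= D2 ->
  (1 - e) * c * N <= c ^+ 2 + (N - 1) * D2 ->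
  c ^+ 2 + (N - 1) * D2 <= c * N ->
  c * (1 - (3 + c) * e) * N ^+ 2 <=
    c ^+ 3 + 3 * c * (N - 1) * D2 + N * (N - 1) ^+ 2 / (N - 2) * D3 ->
  [/\ D2 - D3 <= c * ((3 + c) * e + (3 * c + 3) / N),
      (1 - e) * c - c ^+ 2 / N <= D2 & D2 <= c + 2 * c / N].
Proof.
move=> N4 c0 cN e0 e1 D20 D32 lo hi cub.
have Np : 0 < N by lra.
have Nn0 : N != 0 by rewrite gt_eqF.
have up : N * D2 <= c * N + 2 * c.
  have h1 : (N - 1) * (N * D2) <= (N - 1) * (c * N + 2 * c) by nra.
  by rewrite -(ler_pM2l (x := N - 1)) //; lra.
have dn : (1 - e) * c * N - c ^+ 2 <= N * D2 by nra.
split.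
- have D2c : D2 <= 2 * c by nra.
  have cub' : N * (N - 1) ^+ 2 / (N - 2) * D3 <= N ^+ 2 * D3 + c * N.
    have -> : N * (N - 1) ^+ 2 / (N - 2) * D3 = N ^+ 2 * D3 + (D3 / (N - 2)) * N.
      by field; rewrite gt_eqF //; lra.
    rewrite lerD2l ler_wpM2r ?(ltW Np)// ler_pdivrMr; last by lra.
    nra.
  have key : N ^+ 2 * (D2 - D3) <= N ^+ 2 * (c * (3 + c) * e) + N * (3 * c ^+ 2 + 3 * c).
    have h2 : N * (N * D2) <= N * (c * N + 2 * c) by rewrite ler_pM2l.
    have h3 : 3 * c * ((N - 1) * D2) <= 3 * c * (c * N - c ^+ 2).
      by apply: ler_wpM2l; lra.
    have h4 : 0 <= c ^+ 3 by rewrite exprn_ge0.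
    lra.
  rewrite -(ler_pM2l (x := N ^+ 2)) ?exprn_gt0//.
  apply: le_trans key _; rewrite le_eqVlt; apply/orP; left; apply/eqP; by field.
- rewrite -(ler_pM2l Np); apply: le_trans _ dn.
  rewrite le_eqVlt; apply/orP; left; apply/eqP; by field.
- rewrite -(ler_pM2l Np); apply: le_trans up _.
  rewrite le_eqVlt; apply/orP; left; apply/eqP; by field.
Qed.

(** The quantity y^2 (1 - y) controls the distance from y to {0, 1}: one of the
    factors is bounded below on each side of 1/2. *)
Lemma near_bool_bounds (R : realFieldType) (y : R) : y <= 1 ->
  `|(if 2^-1 <= y then 1 else 0) - y ^+ 2| <= 8 * (y ^+ 2 - y ^+ 3) /\
  (if 2^-1 <= y then 1 - y else 0) <= 4 * (y ^+ 2 - y ^+ 3).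
Proof.
move=> y1; have -> : y ^+ 2 - y ^+ 3 = y ^+ 2 * (1 - y) by ring.
have [y2|y2] := leP 2^-1 y.
  have sq : 4^-1 <= y ^+ 2 by nra.
  have gap : 4^-1 * (1 - y) <= y ^+ 2 * (1 - y) by apply: ler_wpM2r; lra.
  have sq0 := sqr_ge0 (1 - y); have sq1 : y ^+ 2 <= 1 by nra.
  by rewrite ler_norml; split; [apply/andP; split|]; lra.
have gap : y ^+ 2 * 2^-1 <= y ^+ 2 * (1 - y) by apply: ler_wpM2l; [exact: sqr_ge0|lra].
by have y0 := sqr_ge0 y; rewrite sub0r normrN ger0_norm ?sqr_ge0 //; split; lra.
Qed.

(** * Unions of 1-cosets *)

(** Enumerating M first and its complement next, an initial segment of length r
    lies inside M or contains M. *)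
Lemma exists_comparable_set (T : finType) (M : {set T}) r : (r <= #|T|)%N ->
  exists2 M' : {set T}, #|M'| = r & (M' \subset M) || (M \subset M').
Proof.
move=> rT; pose e := enum M ++ enum (~: M).
have ue : uniq e.
  rewrite cat_uniq !enum_uniq andbT /=; apply/hasPn => x.
  by rewrite !mem_enum inE.
have se : size e = #|T| by rewrite size_cat -!cardE cardsC.
exists [set x in take r e].
  by rewrite cardsE (card_uniqP _) ?take_uniq// size_takel// se.
rewrite /e take_cat; case: ifP => _; apply/orP; [left|right]; apply/subsetP => x;
  rewrite inE.
  by move=> /mem_take; rewrite mem_enum.
by rewrite mem_cat mem_enum => ->.
Qed.

Lemma ler_sum_subset (R : realFieldType) (T : finType) (F : T -> R) (K L : {set T}) :
  (forall p, 0 <= F p) -> K \subset L -> \sum_(p in K) F p <= \sum_(p in L) F p.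
Proof.
move=> F0 /subsetP KL; rewrite big_mkcond [leRHS]big_mkcond; apply: ler_sum => p _.
by case: ifP => [/KL ->//|_]; case: ifP.
Qed.

Section CosetUnions.

Variables (R : realFieldType) (n : nat) (A : {set 'S_n}).
Hypothesis n_gt2 : (2 < n)%N.
Let N : R := n%:R.
Let P : R := n.-1`!%:R.
Implicit Types (p q : 'I_n * 'I_n) (M : {set 'I_n * 'I_n}).

Local Notation c := (relsize R A).
Local Notation a := (cosetdens R A).
Local Notation x p s := ((s p.1 == p.2)%:R : R).

Definition coset_family M := [set coset1 p.1 p.2 | p in M].

Let N3 : 3 <= N := natr_ge3 R n_gt2.
Let P_gt0 : 0 < P := fact_pred_gt0 R n.

(** Two distinct 1-cosets are disjoint when they share a row or a column, and
    meet in (n-2)! permutations otherwise. *)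
Lemma coset_overlap p q : p != q ->
  (N - 1) * (\sum_(s : 'S_n) x p s * x q s) <= P.
Proof.
case: p q => [i j] [k l] /= pq; have [ik|ki] := eqVneq k i.
  rewrite big1 ?mulr0 ?(ltW P_gt0)// => s _; case: eqP => [sij|_]; last by rewrite mul0r.
  case: eqP => [skl|_]; last by rewrite mulr0.
  by case/eqP: pq; rewrite -sij -skl ik.
have := @sum_exchange R n [set i] (fun s => x (i, j) s) (fun m => (m == l)%:R) k.
rewrite cards1 natrB ?(ltn_trans _ n_gt2)//= => -> //; last 2 first.
- by move=> p q s; rewrite !inE => pi qi; rewrite permM tpermD.
- by rewrite inE.
rewrite /P -(sum_coset R i j); apply: ler_sum => s _ /=.
rewrite ler_piMr ?ler0n//.
rewrite -[leRHS](sum_pick_perm R s l) big_mkcond; apply: ler_sum => m _.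
by case: ifP => // _; rewrite ler0n.
Qed.

(** For n > 2 the overlap of two distinct pairs is smaller than a 1-coset. *)
Lemma coset1_inj : injective (fun p => coset1 p.1 p.2).
Proof.
move=> p q Tpq; apply/eqP/negP => /negP /coset_overlap.
have -> : \sum_(s : 'S_n) x p s * x q s = \sum_(s : 'S_n) x p s.
  apply: eq_bigr => s _; have /setP/(_ s) := Tpq; rewrite !inE => ->.
  by case: eqP; rewrite ?mulr1 ?mulr0.
by rewrite sum_coset; have := N3; have := P_gt0; nra.
Qed.

Lemma card_coset_family M : #|coset_family M| = #|M|.
Proof. exact: card_imset coset1_inj. Qed.

(** Let X count the cosets of the family that contain s. A permutation outside A
    costs at most X^2, and one in A costs at most (1 - X)^2, since X is a natural
    number that vanishes exactly off the union. Both bounds are linear in X up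
    to X^2 - X, which counts the overlaps. *)
Lemma symmdiff_cover M :
  \sum_s ((s \in A)%:R - (s \in cover (coset_family M))%:R) ^+ 2 <=
  P * (c + #|M|%:R - 2 * (\sum_(p in M) a p.1 p.2) + #|M|%:R ^+ 2 / (N - 1)).
Proof.
pose X (s : 'S_n) := \sum_(p in M) x p s.
have pointwise s : ((s \in A)%:R - (s \in cover (coset_family M))%:R) ^+ 2 <=
    (s \in A)%:R * 1 - 2 * ((s \in A)%:R * X s) + X s + (X s ^+ 2 - X s).
  have -> : (s \in cover (coset_family M)) = [exists p in M, s p.1 == p.2].
    rewrite cover_imset; apply/bigcupP/existsP => [[p pM]|[p /andP[pM sp]]].
      by rewrite inE => sp; exists p; rewrite pM.
    by exists p; rewrite ?inE.
  have Xsum : X s = (\sum_(p in M) (s p.1 == p.2))%:R by rewrite natr_sum.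
  case: existsP => [[p /andP[pM sp]]|none].
    have X1 : 1 <= X s by rewrite Xsum (bigD1 p) //= sp ler1n.
    by case: (s \in A) => /=; nra.
  have -> : X s = 0.
    rewrite /X big1 // => p pM; case: eqP => // sp.
    by case: none; exists p; rewrite pM sp eqxx.
  by case: (s \in A) => /=; lra.
apply: le_trans (ler_sum _ (fun s _ => pointwise s)) _.
rewrite 2!big_split /= sumrB -big_distrr /= !sum_mem sum_in1.
have -> : \sum_(s in A) X s = P * \sum_(p in M) a p.1 p.2.
  rewrite exchange_big big_distrr; apply: eq_bigr => p _ /=.
  by rewrite cosetdensE mulrC divfK // gt_eqF.
have -> : \sum_s X s = P * #|M|%:R.
  rewrite exchange_big /= (eq_bigr _ (fun p _ => sum_coset R p.1 p.2)) sumr_const.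
  by rewrite mulr_natr.
have overlaps : \sum_s (X s ^+ 2 - X s) <= P * (#|M|%:R ^+ 2 / (N - 1)).
  have expand s : X s ^+ 2 - X s = \sum_(p in M) \sum_(q in M | q != p) x p s * x q s.
    rewrite expr2 {1}/X big_distrl -sumrB; apply: eq_bigr => p pM /=.
    rewrite /X (bigD1 p) //= mulrDr big_distrr /= addrAC.
    by case: (s p.1 == p.2); rewrite ?(mulr1, mulr0) subrr add0r.
  rewrite (eq_bigr _ (fun s _ => expand s)) exchange_big /=.
  have pairle p : \sum_(s : 'S_n) \sum_(q in M | q != p) x p s * x q s <= #|M|%:R * (P / (N - 1)).
    rewrite exchange_big /= mulr_natl -sumr_const.
    apply: le_trans (_ : \sum_(q in M | q != p) P / (N - 1) <= _).
      apply: ler_sum => q /andP[_ qp]; rewrite ler_pdivlMr; last by have := N3; lra.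
      by rewrite mulrC coset_overlap // eq_sym.
    rewrite [leLHS]big_mkcondr; apply: ler_sum => q _; case: ifP => // _.
    by rewrite divr_ge0 ?(ltW P_gt0) //; have := N3; lra.
  apply: le_trans (ler_sum _ (fun p _ => pairle p)) _.
  by rewrite sumr_const -[_ *+ _]mulr_natl le_eqVlt; apply/orP; left; apply/eqP; ring.
have := overlaps; rewrite -/P; set B := \sum_s _; set B' := _ / (N - 1); lra.
Qed.

Local Notation d := (excess R A).
Local Notation D2 := (\sum_i \sum_j d i j ^+ 2).
Local Notation D3 := (\sum_i \sum_j d i j ^+ 3).

Definition heavy : {set 'I_n * 'I_n} := [set p | 2^-1 <= d p.1 p.2].

(** D2 - D3 is the sum over all pairs of the function that controls the distance
    to {0, 1} in [near_bool_bounds]. *)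
Lemma heavy_bounds :
  `|#|heavy|%:R - D2| <= 8 * (D2 - D3) /\
  \sum_(p in heavy) (1 - d p.1 p.2) <= 4 * (D2 - D3).
Proof.
rewrite !pair_bigA -sumrB /= -sumr_const big_mkcond -sumrB !big_distrr /=; split.
  apply: le_trans (ler_norm_sum _ _ _) _; apply: ler_sum => p _; rewrite inE.
  by have [] := near_bool_bounds (excess_le1 R A p.1 p.2).
rewrite big_mkcond; apply: ler_sum => p _; rewrite inE.
by have [] := near_bool_bounds (excess_le1 R A p.1 p.2).
Qed.

Variable e : R.
Hypothesis n_gt20 : (20 < n)%N.
Hypothesis c_le : c <= N / 2.
Hypothesis e_ge0 : 0 <= e.
Hypothesis e_le : e <= 16^-1.
Hypothesis err : \sum_s ((s \in A)%:R - level1 R A s) ^+ 2 <= e * c * P.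

Lemma level1_moment_bounds :
  [/\ D2 - D3 <= c * ((3 + c) * e + (3 * c + 3) / N),
      (1 - e) * c - c ^+ 2 / N <= D2 & D2 <= c + 2 * c / N].
Proof.
have N4 : 21 <= N by rewrite ler_nat.
have e1 := e_le.
have c0 := relsize_ge0 R A.
have D20 : 0 <= D2 by apply: sumr_ge0 => i _; apply: sumr_ge0 => j _; exact: sqr_ge0.
have D32 : D3 <= D2.
  apply: ler_sum => i _; apply: ler_sum => j _.
  by have := excess_le1 R A i j; rewrite exprS; have := sqr_ge0 (d i j); nra.
have S2 := sum_level1_sqr R A n_gt2.
have S3 := sum_level1_cube R A n_gt2.
have er := level1_error R A n_gt2; have cub := level1_cube_ge R A n_gt2.
have er0 : 0 <= \sum_s ((s \in A)%:R - level1 R A s) ^+ 2.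
  by apply: sumr_ge0 => s _; exact: sqr_ge0.
move: err er0 S2 S3 er cub; rewrite -/N -/P.
set Q := \sum_s _ ^+ 2; set G2 := \sum_s _ ^+ 2; set G3 := \sum_s _ ^+ 3.
move=> Qe Q0 S2 S3 er cub.
set W := _ + _ * D2 in S2; set V := _ + _ + _ in S3.
have N0 : N != 0 by rewrite gt_eqF; lra.
have QN : Q * N = P * (c * N - W) by rewrite er S2; field.
apply: moment_bounds => //; try lra.
- suff : P * (c * N - W) <= P * (e * c * N) by rewrite ler_pM2l // -/W; lra.
  by rewrite -QN; have := ler_wpM2r (ler0n R n) Qe; rewrite -/N; lra.
- suff : 0 <= P * (c * N - W) by rewrite pmulr_rge0 // -/W; lra.
  by rewrite -QN mulr_ge0 //; lra.
- rewrite -/V -(ler_pM2l P_gt0).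
  have -> : P * V = G3 * N ^+ 2 by rewrite S3; field.
  have h : (3 + c) * Q <= (3 + c) * (e * c * P) by apply: ler_wpM2l; lra.
  have := ler_wpM2r (sqr_ge0 N) (le_trans (lerB (lexx (c * P)) h) cub).
  by apply: le_trans; rewrite le_eqVlt; apply/orP; left; apply/eqP; ring.
Qed.

(** A set of fewer than half a coset has all [d i j] below 1/2, so that D3 is at
    most half of D2; but D2 is about c and D2 - D3 is a small fraction of c. *)
Lemma sparse_set_empty : c < 2^-1 -> c = 0.
Proof.
move=> c2; have c0 := relsize_ge0 R A; have N21 : 21 <= N by rewrite ler_nat.
have [e0 e1] := (e_ge0, e_le).
have [gap lo _] := level1_moment_bounds.
have D32 : D3 <= 2^-1 * D2.
  rewrite big_distrr; apply: ler_sum => i _; rewrite big_distrr; apply: ler_sum => j _ /=.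
  rewrite exprS; apply: ler_wpM2r; first exact: sqr_ge0.
  by have := excess_le R A i j; have := cosetdens_le R A i j; lra.
apply/eqP; rewrite eq_le c0 andbT leNgt; apply/negP => cp.
have iN : N^-1 <= 21^-1 by rewrite lef_pV2 ?posrE; lra.
have iN0 : 0 <= N^-1 by rewrite invr_ge0; lra.
(* 35 / 160 and 9 / 42 bound (3 + c) * e and (3 * c + 3) / N. *)
have eN : c * ((3 + c) * e + (3 * c + 3) / N) <= c * (35 / 160 + 9 / 42).
  by rewrite ler_pM2l //; nra.
have lo' : c * (1 - 1 / 16 - 1 / 42) <= D2.
  apply: le_trans lo.
  have -> : (1 - e) * c - c ^+ 2 / N = c * (1 - e - c / N) by field; lra.
  by rewrite ler_pM2l //; nra.
set x1 := D2 in gap lo' D32 *; set x2 := D3 in gap D32 *; lra.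
Qed.

(** The family is a set of r pairs comparable with [heavy], and r is at least as
    close to c as the integer [#|heavy|] is. The hypothesis [2^-1 <= c] makes c at
    most 2 c^2, which absorbs the error terms that are linear in c. In units of
    c^2 (e + 1/N): D2 - D3 <= 9 and |c - D2| <= 4, so |c - #|heavy|| <= 4 + 8 * 9 = 76
    and the total is 3 * 76 + 2 * 4 * 9 + 8 = 308. *)
Lemma coset_approximation (r : nat) : 2^-1 <= c -> `|c - r%:R| <= 2^-1 ->
  (exists2 M : {set 'I_n * 'I_n}, #|M| = r &
    \sum_s ((s \in A)%:R - (s \in cover (coset_family M))%:R) ^+ 2 <=
      P * (308 * c ^+ 2 * (e + N^-1))) /\
  `|c - r%:R| <= 76 * c ^+ 2 * (e + N^-1).
Proof.
move=> c2 rc; have N21 : 21 <= N by rewrite ler_nat.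
have [e0 e1] := (e_ge0, e_le).
have [gap lo hi] := level1_moment_bounds.
have [mD hD] := heavy_bounds.
have iN0 : 0 <= N^-1 by rewrite invr_ge0; lra.
have cc : c <= 2 * c ^+ 2 by nra.
set z := c ^+ 2 * (e + N^-1).
have gap' : D2 - D3 <= 9 * z.
  apply: le_trans gap _; rewrite /z.
  have : c * e <= 2 * c ^+ 2 * e by apply: ler_wpM2r.
  have : c / N <= 2 * c ^+ 2 / N by apply: ler_wpM2r.
  have : 0 <= c ^+ 2 * e by rewrite mulr_ge0 ?sqr_ge0.
  have : 0 <= c ^+ 2 / N by rewrite mulr_ge0 ?sqr_ge0.
  lra.
have cD : `|c - D2| <= 4 * z.
  rewrite ler_norml /z; move: lo hi.
  have : c * e <= 2 * c ^+ 2 * e by apply: ler_wpM2r.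
  have : c / N <= 2 * c ^+ 2 / N by apply: ler_wpM2r.
  have : 0 <= c ^+ 2 * e by rewrite mulr_ge0 ?sqr_ge0.
  have : 0 <= c ^+ 2 / N by rewrite mulr_ge0 ?sqr_ge0.
  by set x1 := D2 => *; apply/andP; split; lra.
set m := #|heavy| in mD.
have cm : `|c - m%:R| <= 76 * z.
  apply: le_trans (_ : `|c - D2| + `|m%:R - D2| <= _); last by lra.
  by have := ler_normB (c - D2) (m%:R - D2); rewrite opprB addrA subrK.
have near_r : `|c - r%:R| <= `|c - m%:R|.
  have [->//|rm] := eqVneq m r; apply: (le_trans rc).
  have : 1 <= `|m%:R - r%:R| :> R.
    case: ltngtP rm => // mr _; move: mr; rewrite -(ler_nat R) -natr1 => mr.
      by rewrite distrC ler_normr; apply/orP; left; lra.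
    by rewrite ler_normr; apply/orP; left; lra.
  have := ler_normB (c - r%:R) (c - m%:R).
  have -> : c - r%:R - (c - m%:R) = m%:R - r%:R by ring.
  lra.
have bound_r : `|c - r%:R| <= 76 * z by exact: le_trans near_r cm.
split; last by move: bound_r; rewrite /z mulrA.
have r_le : (r <= #|{: 'I_n * 'I_n}|)%N.
  rewrite card_prod card_ord -(ler_nat R) natrM -/N.
  by have := c_le; move: rc; rewrite ler_norml => /andP[]; nra.
have [M Mr comp] := exists_comparable_set heavy r_le.
exists M => //; apply: le_trans (symmdiff_cover M) _; rewrite ler_pM2l // Mr.
have overlap : r%:R ^+ 2 / (N - 1) <= 8 * z.
  (* r <= c + 1/2 <= 2 c *)
  have r2 : r%:R ^+ 2 <= 4 * c ^+ 2 :> R.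
    have -> : 4 * c ^+ 2 = (2 * c) ^+ 2 by ring.
    by rewrite ler_sqr ?nnegrE ?ler0n //; move: rc; rewrite ler_norml => /andP[]; lra.
  rewrite ler_pdivrMr; last by lra.
  have zN : c ^+ 2 <= z * N.
    have -> : z * N = c ^+ 2 + c ^+ 2 * e * N by rewrite /z; field; lra.
    by rewrite lerDl; exact: mulr_ge0 (mulr_ge0 (sqr_ge0 c) e0) (ler0n R n).
  have : 0 <= z * (N - 2).
    by apply: mulr_ge0; [apply: mulr_ge0; [exact: sqr_ge0|lra]|lra].
  lra.
have dens : c + r%:R - 2 * (\sum_(p in M) a p.1 p.2) <=
    `|c - m%:R| + `|m%:R - r%:R| + 2 * (\sum_(p in heavy) (1 - d p.1 p.2)).
  have sumD (K : {set 'I_n * 'I_n}) :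
      \sum_(p in K) (1 - d p.1 p.2) = #|K|%:R - \sum_(p in K) d p.1 p.2.
    by rewrite sumrB sumr_const.
  have da (K : {set 'I_n * 'I_n}) :
      \sum_(p in K) d p.1 p.2 <= \sum_(p in K) a p.1 p.2.
    by apply: ler_sum => p _; exact: excess_le.
  have := ler_norm (c - m%:R); have := ler_norm (m%:R - r%:R : R).
  have := ler_norm (- (c - m%:R)); have := ler_norm (- (m%:R - r%:R) : R).
  rewrite !normrN; case/orP: comp => sub.
    have : \sum_(p in M) (1 - d p.1 p.2) <= \sum_(p in heavy) (1 - d p.1 p.2).
      apply: ler_sum_subset sub => p.
      by rewrite subr_ge0 excess_le1.
    by have := da M; rewrite sumD Mr; lra.
  have : \sum_(p in heavy) a p.1 p.2 <= \sum_(p in M) a p.1 p.2.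
    by apply: ler_sum_subset sub => p; exact: cosetdens_ge0.
  by have := da heavy; rewrite sumD -/m; lra.
have : `|m%:R - r%:R| <= 152 * z.
  apply: le_trans (_ : `|c - r%:R| + `|c - m%:R| <= _); last by lra.
  by have := ler_normB (c - r%:R) (c - m%:R); rewrite opprB addrC addrA subrK.
by move: hD gap' cm overlap dens; rewrite -[_ * _ * (_ + _)]mulrA -/z; lra.
Qed.

End CosetUnions.

(** * Identification of the projection *)

Lemma expect_real (R : realType) n (u : 'S_n -> R) :
  expect (fun s => (u s)%:C) = ((n`!%:R)^-1 * \sum_s u s)%:C.
Proof. by rewrite /expect rmorphM fmorphV rmorph_nat rmorph_sum. Qed.

Lemma inner_span (R : realType) n (X : seq (fun_Sn R n)) (w u : fun_Sn R n) :
  u \in <<X>>%VS -> (forall x, x \in X -> inner w x = 0) -> inner w u = 0.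
Proof.
move=> uX wX; have := @coord_span _ _ _ (in_tuple X) u uX => ->.
have lin : inner w (\sum_i coord (in_tuple X) i u *: (in_tuple X)`_i) =
    \sum_i (Num.conj (coord (in_tuple X) i u : R[i])) * inner w X`_i.
  under [RHS]eq_bigr do rewrite /inner /expect mulrCA big_distrr /=.
  rewrite -big_distrr exchange_big /=; congr (_ * _); apply: eq_bigr => s _.
  rewrite sum_ffunE rmorph_sum big_distrr; apply: eq_bigr => i _ /=.
  by rewrite ffunE rmorphM mulrCA.
by rewrite lin big1 // => i _; rewrite wX ?mulr0 // mem_nth.
Qed.

Lemma projection_unique (R : realType) n (U : {vspace fun_Sn R n}) (f f1 f2 : fun_Sn R n) :
  is_orthogonal_projection U f f1 -> is_orthogonal_projection U f f2 -> f1 = f2.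
Proof.
move=> [f1U o1] [f2U o2]; pose w := f1 - f2.
have wU : w \in U by rewrite rpredB.
have : inner w w = 0.
  rewrite -[RHS]subr0 -{1}(o2 _ wU) -(o1 _ wU) /inner /expect -mulrBr -sumrB.
  congr (_ * _); apply: eq_bigr => s _; rewrite -mulrBl !ffunE; congr (_ * _); ring.
move/eqP; rewrite /inner /expect mulf_eq0 invr_eq0 pnatr_eq0 -leqn0 leqNgt fact_gt0 /=.
move/eqP/psumr_eq0P => ww; apply/eqP; rewrite -subr_eq0; apply/eqP/ffunP => s.
rewrite [RHS]ffunE; apply/eqP; rewrite -mul_conjC_eq0; apply/eqP; apply: ww => // t _.
exact: mul_conjC_ge0.
Qed.

(** [level1] is a combination of indicators of 1-cosets, its constant term
    being spread evenly over all n^2 of them, and [level1_orthogonal] tests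
    f - f1 against each 1-coset. *)
Lemma level1_projection (R : realType) n (A : {set 'S_n}) : (2 < n)%N ->
  is_orthogonal_projection (U1 R n) (indic R A) [ffun s => (level1 R A s)%:C].
Proof.
move=> n2; split.
  have -> : [ffun s => (level1 R A s)%:C] = \sum_(p : 'I_n * 'I_n)
     ((relsize R A / n%:R ^+ 2 + (n%:R - 1) / n%:R * excess R A p.1 p.2)%:C : R[i])
       *: indic R (coset1 p.1 p.2) :> fun_Sn R n.
    apply/ffunP => s; rewrite ffunE sum_ffunE level1_coset_sum // rmorph_sum.
    by apply: eq_bigr => p _; rewrite !ffunE inE rmorphM rmorph_nat.
  by apply: memv_suml => p _; apply: memvZ; apply: memv_span; apply: image_f.
move=> u uU; apply: inner_span uU _ => x /imageP[[i j] _ ->] /=.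
transitivity (expect (n := n) (fun s => (((s \in A)%:R - level1 R A s) * (s i == j)%:R)%:C)).
  rewrite /inner /expect; congr (_ * _); apply: eq_bigr => s _.
  by rewrite !ffunE inE rmorphM rmorphB !rmorph_nat.
by rewrite expect_real level1_orthogonal // mulr0.
Qed.

(** * The stability theorem *)

(** The cosets are taken with a common i: these are disjoint for every n, while
    for n = 2 two different pairs (i, j) can give the same coset. *)
Lemma exists_cosets n r : (0 < n)%N -> (r <= n)%N ->
  exists2 F : {set {set 'S_n}}, F \subset cosets1 n & #|F| = r.
Proof.
move=> n0 rn; pose i0 := Ordinal n0.
have [|J Jr _] := @exists_comparable_set 'I_n set0 r; first by rewrite card_ord.
exists [set coset1 i0 j | j in J].
  by apply/subsetP => _ /imsetP[j _ ->]; apply/imset2P; exists i0 j.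
rewrite card_imset // => j k /setP/(_ (tperm i0 j)).
by rewrite !inE tpermL eqxx => /esym/eqP.
Qed.

Lemma symmdiff_le n (R : realFieldType) (A B : {set 'S_n}) :
  \sum_s ((s \in A)%:R - (s \in B)%:R) ^+ 2 <= n`!%:R :> R.
Proof.
rewrite -card_Sn -sumr_const; apply: ler_sum => s _.
by case: (_ \in _); case: (_ \in _); rewrite /=; lra.
Qed.

Lemma small_part_bound (R : realFieldType) (C0 big P c eta : R) :
  0 <= c -> 1 <= c * P -> P <= big -> 20 * big <= C0 -> 20^-1 <= eta ->
  c <= C0 * c ^+ 2 * eta.
Proof.
move=> c0 cP Pbig C0_big eta20.
have cbig : 1 <= c * big by apply: le_trans cP _; rewrite ler_wpM2l.
have C0c : 20 <= c * C0 by apply: le_trans (ler_wpM2l c0 C0_big); lra.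
have C0ce : 1 <= c * C0 * eta by nra.
have -> : C0 * c ^+ 2 * eta = c * (c * C0 * eta) by ring.
by rewrite ler_peMr.
Qed.

Lemma large_part_bound (R : realFieldType) (C0 N c eta : R) :
  2000 <= C0 -> N <= 20 -> 2^-1 <= c -> 20^-1 <= eta -> N <= C0 * c ^+ 2 * eta.
Proof.
move=> C0_2000 N20 c2 eta20.
have c4 : 4^-1 <= c ^+ 2 by nra.
have C0c : 500 <= C0 * c ^+ 2 by nra.
nra.
Qed.

Lemma int_close_le (R : realFieldType) (N c r : R) :
  1 <= N -> c <= N / 2 -> `|c - r| <= 2^-1 -> r <= N.
Proof. by move=> N1 cN; rewrite ler_norml => /andP[]; lra. Qed.

(** The theorem over the reals, with sqrt(eps) + 1/n replaced by any number eta
    at least e + 1/n. The summand 20 * 19! of C0 handles 0 < c < 1/2 with n <= 20,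
    where c >= 1 / (n-1)!. *)
Lemma coset_union_stability (R : realFieldType) : exists2 C0 : R, 0 < C0 &
  forall n (A : {set 'S_n}) (e eta : R) (r : nat), let c := relsize R A in
    (0 < n)%N -> c <= n%:R / 2 -> 0 <= e -> e <= 16^-1 -> e + n%:R^-1 <= eta ->
    ((2 < n)%N -> \sum_s ((s \in A)%:R - level1 R A s) ^+ 2 <= e * c * n.-1`!%:R) ->
    `|c - r%:R| <= 2^-1 -> (c < 2^-1 -> r = 0%N) ->
  (exists F : {set {set 'S_n}},
    [/\ F \subset cosets1 n, #|F| = r &
     \sum_s ((s \in A)%:R - (s \in cover F)%:R) ^+ 2 <=
       n.-1`!%:R * (C0 * c ^+ 2 * eta)]) /\
  `|c - r%:R| <= C0 * c ^+ 2 * eta.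
Proof.
have [big [big1 fact_big]] : exists big : R,
    1 <= big /\ forall n, (n <= 20)%N -> n.-1`!%:R <= big.
  exists 19`!%:R; split=> [|n n20]; first by rewrite ler1n fact_gt0.
  by rewrite ler_nat; apply: leq_fact; rewrite -ltnS; case: n n20.
have [C0 C0_2000 C0_big] : exists2 C0 : R, 2000 <= C0 & 20 * big <= C0.
  by exists (2000 + 20 * big); lra.
exists C0; first by lra.
move=> n A e eta r c n0 cn e0 e1 eta_ge err rc r0.
pose N : R := n%:R; pose P : R := n.-1`!%:R.
have P1 : 1 <= P by rewrite ler1n fact_gt0.
have N1 : 1 <= N by rewrite ler1n.
have nf : n`!%:R = N * P :> R by rewrite -natrM -{1}(prednK n0) factS prednK.
have c0 : 0 <= c := relsize_ge0 R A.
have cA : #|A|%:R = c * P by rewrite /c /relsize divfK // gt_eqF // (lt_le_trans _ P1).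
have iN0 : 0 <= N^-1 by rewrite invr_ge0 ler0n.
(* For c < 1/2 the approximating union is empty, at distance c / n. *)
have empty : c < 2^-1 -> c <= C0 * c ^+ 2 * eta ->
    (exists F : {set {set 'S_n}},
    [/\ F \subset cosets1 n, #|F| = r &
     \sum_s ((s \in A)%:R - (s \in cover F)%:R) ^+ 2 <= P * (C0 * c ^+ 2 * eta)]) /\
    `|c - r%:R| <= C0 * c ^+ 2 * eta.
  move=> /r0 -> cb; rewrite subr0 ger0_norm //; split=> //.
  exists set0; rewrite sub0set cards0; split=> //.
  apply: le_trans (_ : P * c <= _); last by rewrite ler_pM2l // (lt_le_trans _ P1).
  rewrite mulrC -cA -sum1_card natr_sum [leRHS]big_mkcond; apply: ler_sum => s _.
  rewrite /cover big_set0 inE subr0.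
  by case: (s \in A); rewrite ?expr1n ?expr0n.
have [n20|n20] := ltnP 20 n; last first.
  have N20 : N <= 20 by rewrite ler_nat.
  have eta20 : 20^-1 <= eta.
    apply: le_trans eta_ge; apply: le_trans (_ : N^-1 <= _); last by rewrite lerDr.
    by rewrite lef_pV2 ?posrE ?(lt_le_trans _ N1) // ltr0n.
  have [c2|c2] := ltP c 2^-1.
    apply: empty => //; have [c_eq0 | cn0] := eqVneq c 0.
      by rewrite c_eq0 expr2 !mul0r mulr0 mul0r.
    apply: (small_part_bound c0 _ (fact_big n n20) C0_big eta20).
    rewrite -/P -cA ler1n lt0n -(eqr_nat R) cA mulf_neq0 //.
    by rewrite gt_eqF // (lt_le_trans _ P1).
  have large := large_part_bound C0_2000 N20 c2 eta20.
  have rn : (r <= n)%N.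
    by rewrite -(ler_nat R); have := int_close_le N1 cn rc.
  have [F Fsub Fr] := exists_cosets n0 rn.
  split; last by apply: le_trans rc _; apply: le_trans large; lra.
  exists F; split=> //; apply: le_trans (symmdiff_le R A (cover F)) _.
  by rewrite nf mulrC ler_pM2l // (lt_le_trans _ P1).
have n2 : (2 < n)%N by exact: ltn_trans n20.
have [c2|c2] := ltP c 2^-1.
  apply: empty => //.
  by rewrite /c (sparse_set_empty n2 n20 cn e0 e1 (err n2) c2) expr2 !mul0r mulr0 mul0r.
have [[M Mr MA] cr] := coset_approximation n2 n20 cn e0 e1 (err n2) c2 rc.
have scale (k : nat) : (k <= 2000)%N ->
    k%:R * c ^+ 2 * (e + N^-1) <= C0 * c ^+ 2 * eta.
  rewrite -(ler_nat R) => k2000; apply: ler_pM => //.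
  - by rewrite mulr_ge0 ?sqr_ge0.
  - by rewrite addr_ge0.
  - by rewrite ler_wpM2r ?sqr_ge0 // (le_trans k2000).
split; last exact: le_trans cr (scale 76%N isT).
exists (coset_family M); split.
- by apply/subsetP => _ /imsetP[p _ ->]; apply/imset2P; exists p.1 p.2.
- by rewrite (card_coset_family R).
- by apply: le_trans MA _; rewrite ler_pM2l ?(lt_le_trans _ P1) // (scale 308%N).
Qed.

Lemma roundP (R : realType) (c : R) : 0 <= c -> exists r : nat,
  [/\ r%:Z = round c, `|c - r%:R| <= 2^-1 & (c < 2^-1 -> r = 0%N)].
Proof.
move=> c0; have /andP[lo hi] := floor_itv (c + 2^-1).
have z0 : 0 <= round c by rewrite /round floor_ge0; lra.
exists `|round c|%N; rewrite natr_absz (ger0_norm z0) gez0_abs //.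
move: lo hi; rewrite -/(round c) intrD => lo hi; split => //.
  by rewrite ler_norml; apply/andP; split; lra.
move=> c2; have : round c < 1 by rewrite -(ltr_int R); lra.
by move: (round c) z0 => z; lia.
Qed.

Theorem theorem1 (R : realType) :
  exists C0 eps0 : R, 0 < C0 /\ 0 < eps0 /\
  forall (n : nat) (A : {set 'S_n}) (c eps : R) (f f1 : fun_Sn R n),
    (0 < n)%N ->
    #|A|%:R = c * ((n.-1)`!)%:R ->
    c <= n%:R / 2 ->
    f = indic R A ->
    is_orthogonal_projection (U1 R n) f f1 ->
    0 <= eps ->
    eps <= eps0 ->
    expect (fun s => (f s - f1 s) ^+ 2) <= (eps * c / n%:R)%:C ->
    (exists ft : fun_Sn R n,
      [/\ Boolean_fun ft,
          expect (fun s => (f s - ft s) ^+ 2)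
            <= (C0 * c ^+ 2 * (Num.sqrt eps + n%:R^-1) / n%:R)%:C
        & exists F : {set {set 'S_n}},
            [/\ F \subset cosets1 n,
                #|F|%:Z = round c
              & ft = indic R (cover F)]])
    /\ `|c - (round c)%:~R| <= C0 * c ^+ 2 * (Num.sqrt eps + n%:R^-1).
Proof.
have [C0 C0_gt0 stab] := coset_union_stability R.
exists C0, 16^-1; split=> //; split; first by rewrite invr_gt0.
move=> n A c e f f1 n0 cA cn -> proj e0 e1 err.
set eta := Num.sqrt e + _.
have P0 : n.-1`!%:R != 0 :> R by rewrite pnatr_eq0 -lt0n fact_gt0.
have N0 : n%:R != 0 :> R by rewrite pnatr_eq0 -lt0n.
have nf : n`!%:R = n%:R * n.-1`!%:R :> R by rewrite -natrM -{1}(prednK n0) factS prednK.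
have nf_gt0 : 0 < n`!%:R :> R by rewrite ltr0n fact_gt0.
have cE : c = relsize R A by rewrite /relsize cA mulfK.
have c0 : 0 <= c by rewrite cE relsize_ge0.
have eta_ge : e + n%:R^-1 <= eta.
  rewrite lerD2r -{1}(sqr_sqrtr e0) expr2 ler_piMl ?sqrtr_ge0//.
  rewrite -sqrtr1 ler_wsqrtr // (le_trans e1) // invf_le1 ?ler1n //.
have expect_diff (ft : fun_Sn R n) u : (forall s, ft s = (u s)%:C) ->
    expect (fun s => (indic R A s - ft s) ^+ 2) =
    (n`!%:R^-1 * \sum_(s : 'S_n) ((s \in A)%:R - u s) ^+ 2)%:C.
  move=> ftu; rewrite -expect_real; congr (_ * _); apply: eq_bigr => s _.
  by rewrite ftu ffunE rmorphXn rmorphB rmorph_nat.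
have [r [rE rc r0]] := roundP c0.
have errR : (2 < n)%N ->
    \sum_s ((s \in A)%:R - level1 R A s) ^+ 2 <= e * c * n.-1`!%:R.
  move=> n2; move: err.
  rewrite (projection_unique proj (level1_projection R A n2)).
  rewrite (expect_diff _ (level1 R A)) => [|s]; last by rewrite ffunE.
  rewrite lecR ler_pdivrMl // nf.
  by have -> : n%:R * n.-1`!%:R * (e * c / n%:R) = e * c * n.-1`!%:R by field.
have := stab n A e eta r; rewrite /= -cE => /(_ n0 cn e0 e1 eta_ge errR rc r0).
rewrite -rE => -[[F [Fsub Fr FA]] cr]; split=> //.
exists (indic R (cover F)); split.
- by move=> s; rewrite ffunE; case: (s \in _); [right|left].
- rewrite (expect_diff _ (fun s => (s \in cover F)%:R)) => [|s]; last first.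
    by rewrite ffunE rmorph_nat.
  rewrite lecR ler_pdivrMl //; apply: le_trans FA _.
  by rewrite nf le_eqVlt; apply/orP; left; apply/eqP; field.
- by exists F; rewrite Fr.
Qed.
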